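(* Let $n$ be a positive integer and let $t_n$ be an integer with $1 \leq t_n \leq \frac{n^{1/3}}{6}$. Then for every integer $d_n$ satisfying $4t_n \leq d_n \leq \frac{2n}{3t_n^2}$ there exists a code $\mathcal{C}_{frac} \subseteq \{0,1\}^n$ with real-time delay $d_n$ whose redundancy satisfies \[ R(\mathcal{C}_{frac}) \leq n \cdot \frac{4\log(2d_n)}{d_n}, \] and whose $(t_n,d_n)$-real-time error probability satisfies \[ \rho(t_n,d_n) \leq 11\,\frac{t_n^2 d_n}{n}. \]
   Context: All logarithms are to base $2$. A word of length $n$ is $\mathbf{x}=(x_1,\dots,x_n)\in\{0,1\}^n$. A deletable error pattern of length $n$ is a pair $\mathbf{g}=(\mathbf{e},\mathbf{v})$ with $\mathbf{e}=(e_1,\dots,e_n)\in\{0,1\}^n$ and $\mathbf{v}=(s_1,\dots,s_n)\in\{D,E,F\}^n$. The corrupted word $F_{\mathbf{g}}(\mathbf{x})$ is obtained from $\mathbf{x}$ as follows: for each $i$ with $e_i=1$, the bit $x_i$ is deleted if $s_i=D$, replaced by an erasure symbol $\varepsilon$ if $s_i=E$, and replaced by $1-x_i$ if $s_i=F$; bits with $e_i=0$ are unchanged (the result is a string over $\{0,1,\varepsilon\}$, possibly shorter than $n$). For $1\le t\le n$, $F_{\mathbf{g}}(\mathbf{x},t)$ denotes the result of corrupting the first $t$ bits of $\mathbf{x}$ according to the first $t$ entries of $\mathbf{g}$ (i.e. the corrupted output restricted to the contribution of $x_1,\dots,x_t$). For $r\ge1$, $\mathcal{E}_n(r)$ is the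 set of all length-$n$ deletable error patterns with $\sum_i e_i\le r$. An $n$-length code is a subset $\mathcal{C}\subseteq\{0,1\}^n$; its redundancy is $R(\mathcal{C})=n-\log(\#\mathcal{C})$. For an integer $d\ge1$ and a set $\mathcal{F}$ of error patterns, $\mathcal{C}$ corrects all patterns in $\mathcal{F}$ in real time with delay at most $d$ if for every $1\le z\le n-d$, all $\mathbf{g}_1,\mathbf{g}_2\in\mathcal{F}$ and all $\mathbf{x}_1\ne\mathbf{x}_2\in\mathcal{C}$, one has $F_{\mathbf{g}_1}(\mathbf{x}_1,z+d)\ne F_{\mathbf{g}_2}(\mathbf{x}_2,z+d)$. For integers $t,d\ge1$, let $\mathcal{F}(t,d)\subseteq\mathcal{E}_n(t)$ be a set of maximum size of error patterns that $\mathcal{C}$ corrects in real time with delay $d$; the $(t,d)$-real-time error probability of $\mathcal{C}$ is $\rho(t,d)=\frac{\#(\mathcal{E}_n(t)\setminus\mathcal{F}(t,d))}{\#\mathcal{E}_n(t)}$.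
   Formalization: Real-time correction is required only for codewords differing in their first z bits (so not for those differing only in the last d bits); required for all distinct codewords, as written, z=1 forces #C ≤ 2^(d+1), and the claim fails, e.g. t=1, d=100, n=10^6. *)

(* Defs.v *)
From Stdlib Require Import Reals.
From HB Require Import structures.
From mathcomp Require Import all_boot.
Set Implicit Arguments. Unset Strict Implicit. Unset Printing Implicit Defensive.

(* Error type of a single position: Deletion, Erasure, Flip. *)
Inductive errsym := SD | SE | SF.

Definition errsym_to (s : errsym) : 'I_3 :=
  match s with SD => inord 0 | SE => inord 1 | SF => inord 2 end.
Definition errsym_of (i : 'I_3) : errsym :=
  match val i with 0 => SD | 1 => SE | _ => SF end.
Lemma errsymK : cancel errsym_to errsym_of.
Proof. by case; rewrite /errsym_of /= inordK. Qed.

HB.instance Definition _ := Finite.copy errsym (can_type errsymK).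

Definition word n := {ffun 'I_n -> bool}.
(* A deletable error pattern g = (e, v): position i carries (e_i, s_i). *)
Definition pattern n := {ffun 'I_n -> bool * errsym}.
(* Output symbols: Some b is the bit b, None is the erasure symbol. *)
Definition osym := option bool.

Definition corrupt_at n (x : word n) (g : pattern n) (i : 'I_n) : seq osym :=
  if (g i).1 then
    match (g i).2 with
    | SD => [::]
    | SE => [:: None]
    | SF => [:: Some (~~ x i)]
    end
  else [:: Some (x i)].

Definition corrupt_prefix n (x : word n) (g : pattern n) (t : nat) : seq osym :=
  flatten [seq corrupt_at x g i | i : 'I_n <- enum 'I_n & (nat_of_ord i < t)%N].

Definition corrupt n (x : word n) (g : pattern n) : seq osym :=
  corrupt_prefix x g n.

Definition errpats n (r : nat) : {set pattern n} :=
  [set g : pattern n | (\sum_(i < n) (g i).1 <= r)%N].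

Definition rt_corrects n (C : {set word n}) (F : {set pattern n}) (d : nat) : bool :=
  [forall z : 'I_n.+1, ((1 <= z) && (z <= n - d))%N ==>
    [forall g1 in F, forall g2 in F, forall x1 in C, forall x2 in C,
      [exists i : 'I_n, (i < z)%N && (x1 i != x2 i)] ==>
      (corrupt_prefix x1 g1 (z + d) != corrupt_prefix x2 g2 (z + d))]].

Definition max_rt_corrected n (C : {set word n}) (t d : nat) : nat :=
  \max_(F : {set pattern n} | (F \subset errpats n t) && rt_corrects C F d) #|F|.

Local Open Scope R_scope.

Definition log2 (x : R) : R := ln x / ln 2.

Definition redundancy n (C : {set word n}) : R := INR n - log2 (INR #|C|).

Definition rt_error_prob n (C : {set word n}) (t d : nat) : R :=
  INR (#|errpats n t| - max_rt_corrected C t d)%N / INR #|errpats n t|.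

(* Main.v *)
(** Cut the positions into blocks of length B = d. Every codeword starts each
   block with the marker 01, and the Varshamov-Tenengolts sum of each block is
   prescribed modulo 2B; by pigeonhole on the sums and on the overwritten bits,
   some choice of the sums leaves at least 2^n / (8d)^(n/d + 1) codewords.

   The corrected patterns are those whose errors are pairwise at distance at
   least 5d + 2. Let two codewords and two such patterns yield the same output
   on a prefix. Call a position synchronised if both outputs of what precedes it
   have the same length. A deletion in one pattern misaligns the markers by one,
   so the other pattern must delete within two blocks: synchronised positions
   are dense, and each complete block lies between two of them less than 5d + 2
   apart. Between these, each pattern has at most one error, and either both or
   none is a deletion, so the Varshamov-Tenengolts sums force the blocks to agree.

   Finally all pairs of distinct positions carry a joint error equally often, so
   at most a fraction (5d + 1) t^2 / (n - 1) of the patterns is not corrected. *)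

Require Import Defs.
From Stdlib Require Import Reals.
From mathcomp Require Import all_boot.
From Stdlib Require Import Lra.
From mathcomp Require Import all_fingroup zify.
Set Implicit Arguments. Unset Strict Implicit. Unset Printing Implicit Defensive.

(** * Varshamov-Tenengolts sums *)

(** The argument is a function on [nat], so that a block of a longer word is just a shifted
    function. *)
Definition vt_sum (B : nat) (y : nat -> bool) : nat := \sum_(j < B) j.+1 * y j.

Lemma vt_sum_split2 B y a b : a < b < B ->
  vt_sum B y = a.+1 * y a + b.+1 * y b
    + \sum_(j < B | (j != a :> nat) && (j != b :> nat)) j.+1 * y j.
Proof.
move=> /andP[ab bB]; have aB := ltn_trans ab bB.
rewrite /vt_sum (bigD1 (Ordinal aB)) //= (bigD1 (Ordinal bB)) /=; last first.
  by apply/eqP => /(congr1 val) /=; lia.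
by rewrite addnA; congr (_ + _); apply: eq_bigl => j; rewrite -!val_eqE.
Qed.

Lemma vt_sum_split1 B y a : a < B ->
  vt_sum B y = a.+1 * y a + \sum_(j < B | j != a :> nat) j.+1 * y j.
Proof.
by move=> aB; rewrite /vt_sum (bigD1 (Ordinal aB)).
Qed.

Lemma eqn_mod_small k l c M : l + c = k + c %[mod M] -> l < M -> k < M -> l = k.
Proof. by move/eqP; rewrite eqn_modDr => /eqP h lM kM; rewrite !modn_small in h. Qed.

(** For [a < b < B] the weights [a.+1] and [b.+1] are distinct and add up to less than [2 * B], so
    the residue determines both bits. An index from [B] on stands for no difference. *)
Lemma vt_flips B y1 y2 a b : a <= b ->
  (forall j, j < B -> j != a -> j != b -> y1 j = y2 j) ->
  vt_sum B y1 = vt_sum B y2 %[mod 2 * B] ->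
  forall j, j < B -> y1 j = y2 j.
Proof.
have one c : (forall j, j < B -> j != c -> y1 j = y2 j) ->
    vt_sum B y1 = vt_sum B y2 %[mod 2 * B] -> forall j, j < B -> y1 j = y2 j.
  move=> h e j jB; case: (eqVneq j c) => [ejc|/h]; last exact.
  subst c; move: e; rewrite !(vt_sum_split1 _ jB).
  rewrite (eq_bigr (fun i : 'I_B => i.+1 * y2 i)); last first.
    by move=> i ij; rewrite h.
  by move/eqn_mod_small; case: (y1 j); case: (y2 j) => // /(_ _ _)/eqP; lia.
move=> ab h e; case: (ltnP b B) => bB; last first.
  by apply: (one a) => // j jB ja; apply: h => //; lia.
case: (eqVneq a b) => [eab|nab].
  by apply: (one a) => // j jB ja; apply: h => //; rewrite -eab.
have abB : a < b < B by lia.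
move: e; rewrite !(vt_sum_split2 _ abB).
rewrite (eq_bigr (fun i : 'I_B => i.+1 * y2 i)); last first.
  by move=> i /andP[ia ib]; rewrite h.
move/eqn_mod_small => e j jB.
have {}e : a.+1 * y1 a + b.+1 * y1 b = a.+1 * y2 a + b.+1 * y2 b.
  by apply: e; [case: (y1 a); case: (y1 b) | case: (y2 a); case: (y2 b)]; lia.
case: (eqVneq j a) => [->|ja]; last case: (eqVneq j b) => [->|jb].
- by case: (y1 a) e; case: (y1 b); case: (y2 a); case: (y2 b) => //; lia.
- by case: (y1 a) e; case: (y1 b); case: (y2 a); case: (y2 b) => //; lia.
exact: h.
Qed.

Lemma vt_sum_nat B y : vt_sum B y = \sum_(0 <= j < B) j.+1 * y j.
Proof. by rewrite big_mkord. Qed.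

(* The hypotheses say that deleting position [p] of [y1] and position [q] of
   [y2] gives the same word. *)
Lemma vt_deletions B y1 y2 p q : p <= q < B ->
  (forall j, j < p -> y1 j = y2 j) ->
  (forall j, p <= j < q -> y1 j.+1 = y2 j) ->
  (forall j, q < j < B -> y1 j = y2 j) ->
  vt_sum B y1 = vt_sum B y2 %[mod 2 * B] ->
  forall j, j < B -> y1 j = y2 j.
Proof.
move=> /andP[pq qB] hl hm hr.
have split y : vt_sum B y = \sum_(0 <= j < p) j.+1 * y j
    + \sum_(p <= j < q.+1) j.+1 * y j + \sum_(q.+1 <= j < B) j.+1 * y j.
  rewrite vt_sum_nat (big_cat_nat (n := p)) //=; last lia.
  by rewrite (big_cat_nat (n := q.+1) (m := p)) //=; lia.
set ones := \sum_(p <= j < q) (y2 j : nat).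
have e1 : \sum_(p <= j < q.+1) j.+1 * y1 j =
    p.+1 * y1 p + (\sum_(p <= j < q) j.+1 * y2 j + ones).
  rewrite big_ltn //; congr (_ + _).
  rewrite big_add1 /= -big_split /=; apply: eq_big_nat => j pjq.
  by rewrite hm // mulSn addnC.
have e2 : \sum_(p <= j < q.+1) j.+1 * y2 j =
    \sum_(p <= j < q) j.+1 * y2 j + q.+1 * y2 q by rewrite big_nat_recr.
rewrite !split e1 e2.
rewrite (eq_big_nat _ _ (F2 := fun j => j.+1 * y2 j) (m := 0)); last first.
  by move=> j /andP[_ jp]; rewrite hl.
rewrite (eq_big_nat _ _ (F2 := fun j => j.+1 * y2 j) (m := q.+1)); last first.
  by move=> j qjB; rewrite hr.
set u := \sum_(0 <= j < p) _; set v := \sum_(p <= j < q) _; set w := \sum_(q.+1 <= j < B) _.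
rewrite [X in X = _ %[mod _]](_ : _ = (p.+1 * y1 p + ones) + (u + v + w)); last lia.
rewrite [X in _ = X %[mod _]](_ : _ = q.+1 * y2 q + (u + v + w)); last lia.
have ones_le : ones <= q - p.
  by rewrite -[q - p]muln1 -sum_nat_const_nat; apply: leq_sum => j _; case: (y2 j).
move/eqn_mod_small => e.
(* Both sides are at most [q.+1 <= B], hence below the modulus. *)
have {}e : p.+1 * y1 p + ones = q.+1 * y2 q.
  by apply: e; case: (y1 p); case: (y2 q); lia.
have sum_le l h : \sum_(l <= j < h) (y2 j : nat) <= h - l.
  by rewrite -[h - l]muln1 -sum_nat_const_nat; apply: leq_sum => j _; case: (y2 j).
have ypq : y1 p = y2 q by move: e; case: (y1 p); case: (y2 q) => //; lia.
(* If [y1 p] is [false] the equation leaves only [ones = 0], if [true] only [ones = q - p]. Either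
   way the bits in between are constant and equal to both deleted bits, and all deletions within a
   run give the same word. *)
have y2c j : p <= j < q -> y2 j = y1 p.
  move=> pjq; have := e; rewrite /ones (big_cat_nat (n := j)) /=; [|lia|lia].
  rewrite (big_ltn (m := j)); last lia.
  have := sum_le p j; have := sum_le j.+1 q; rewrite -ypq.
  by case: (y1 p); case: (y2 j) => //; lia.
move=> j jB; case: (ltnP j p) => [/hl//|pj]; case: (ltnP q j) => [qj|jq].
  by apply: hr; rewrite qj.
have -> : y2 j = y1 p.
  by case: (eqVneq j q) => [->|jnq]; [rewrite ypq | apply: y2c; lia].
case: (eqVneq j p) => [->//|jnp]; case: j jB pj jq jnp => [|j] jB pj jq jnp; first lia.
by rewrite hm ?y2c; lia.
Qed.

(** * Synchronisation of two corrupted outputs *)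

(** A channel is given by the list [c i] that it emits at each position [i], which treats the three
    kinds of error alike. *)
Definition output (c : nat -> seq osym) (a : nat) : seq osym :=
  flatten [seq c i | i <- iota 0 a].

Definition altered (X : nat -> bool) (c : nat -> seq osym) (i : nat) : bool :=
  c i != [:: Some (X i)].

Definition sparse w X c :=
  (forall i, size (c i) <= 1) /\
  (forall i j, i < j -> altered X c i -> altered X c j -> i + w <= j).

Definition synced c1 c2 a := size (output c1 a) == size (output c2 a).

Lemma output_cat c a b : a <= b ->
  output c b = output c a ++ flatten [seq c i | i <- iota a (b - a)].
Proof.
by move=> ab; rewrite /output -{1}(subnKC ab) iotaD map_cat flatten_cat add0n.
Qed.

Lemma outputS c a : output c a.+1 = output c a ++ c a.
Proof. by rewrite (output_cat c (leqnSn a)) subSnn /= cats0. Qed.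

Lemma size_output_run c a b : a <= b -> (forall i, a <= i < b -> size (c i) = 1) ->
  size (output c b) = size (output c a) + (b - a).
Proof.
move=> /subnKC <-; elim: (b - a) => [|k IH] h; first by rewrite addn0 subnn addn0.
rewrite addnS outputS size_cat IH; last by move=> i ?; apply: h; lia.
by rewrite h; lia.
Qed.

(** Equal outputs are compared through this index: prefixes of equal length put the next two symbols
    opposite each other. *)
Lemma output_nth c a T : a < T -> size (c a) = 1 ->
  c a = [:: nth None (output c T) (size (output c a))].
Proof.
move=> aT; rewrite (output_cat c aT) outputS -catA nth_cat ltnn subnn.
by case: (c a) => [|x [|]].
Qed.

Lemma nth_unaltered X c a T : a < T -> ~~ altered X c a ->
  nth None (output c T) (size (output c a)) = Some (X a).
Proof.
by move=> aT /negPn/eqP e; have := @output_nth c a T aT; rewrite e => /(_ erefl) [].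
Qed.

Section Sparse.
Context (w : nat) (X : nat -> bool) (c : nat -> seq osym).
Hypothesis sp : sparse w X c.

Lemma unaltered_size i : ~~ altered X c i -> size (c i) = 1.
Proof. by move/negPn/eqP => ->. Qed.

Lemma erased_altered q : size (c q) = 0 -> altered X c q.
Proof. by rewrite /altered; case: (c q). Qed.

Lemma sparse_unaltered q i : altered X c q -> i != q -> i < q + w -> q < i + w ->
  ~~ altered X c i.
Proof.
move=> aq iq h1 h2; apply/negP => ai; case: sp => _ far.
case: (ltngtP i q) iq => // iq _.
- by have := far _ _ iq ai aq; lia.
- by have := far _ _ iq aq ai; lia.
Qed.

(** A window of at most [w] positions has room for one alteration only, so the deletion at [q] is
    the sole change of length; the boolean [q < a] is the resulting lag. *)
Lemma size_output_deletion L R q : L <= q < R -> R <= L + w -> size (c q) = 0 ->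
  forall a, L <= a <= R ->
  size (output c a) + (q < a) = size (output c L) + (a - L).
Proof.
move=> Lq Rw cq a La; have aq := erased_altered cq.
have one i : L <= i < R -> i != q -> size (c i) = 1.
  by move=> Li iq; apply/unaltered_size/(sparse_unaltered aq) => //; lia.
case: (ltnP q a) => qa /=.
  rewrite (@size_output_run c q.+1 a) //; last by move=> i ?; apply: one; lia.
  rewrite outputS size_cat cq (@size_output_run c L q); first lia; first lia.
  by move=> i ?; apply: one; lia.
rewrite addn0; apply: size_output_run; first lia.
by move=> i ?; apply: one; lia.
Qed.

End Sparse.

Definition marked B T (X : nat -> bool) :=
  forall k, (k * B).+1 < T -> X (k * B) = false /\ X (k * B).+1 = true.

(* A shift by one puts the symbol 1 of a marker of [X1] opposite the symbol 0
   of the same marker of [X2]; a single alteration in [c2] cannot repair two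
   consecutive markers, so [c2] must soon make up for the deletion. *)
Lemma next_sync_deletion w B T X1 X2 c1 c2 L :
  1 < B -> 2 * B + 2 <= w -> sparse w X1 c1 -> sparse w X2 c2 ->
  marked B T X1 -> marked B T X2 -> output c1 T = output c2 T ->
  L < T -> synced c1 c2 L -> size (c1 L) = 0 -> size (c2 L) = 1 ->
  exists2 R, L < R <= T & R <= L + (2 * B + 2) /\ synced c1 c2 R.
Proof.
move=> B1 Bw sp1 sp2 m1 m2 eqT LT /eqP sL d1 s2.
(* Near the end, [T] itself is synchronised, because the outputs up to [T] are equal. *)
case: (leqP T (L + (2 * B + 2))) => TL.
  by exists T; [rewrite LT leqnn | rewrite /synced eqT].
have size1 := @size_output_deletion _ _ _ sp1 L (L + (2 * B + 2)) L _ _ d1.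
have {}size1 a : L < a <= L + (2 * B + 2) ->
    (size (output c1 a)).+1 = size (output c2 L) + (a - L).
  by move=> La; rewrite -sL -size1; lia.
case: (boolP [exists i : 'I_(2 * B + 1), size (c2 (L.+1 + i)) == 0]).
  case/existsP => i /eqP; set q := L.+1 + i => d2.
  have qb : L < q <= L + 2 * B + 1 by have := ltn_ord i; lia.
  exists q.+1; first lia; split; first lia.
  have := @size_output_deletion _ _ _ sp2 L (L + (2 * B + 2)) q _ _ d2 q.+1.
  by have := size1 q.+1; rewrite /synced; lia.
move/existsPn => nodel.
have run2 i : L <= i < L + (2 * B + 2) -> size (c2 i) = 1.
  case: (eqVneq i L) => [->//|iL Li].
  have hi : i - L.+1 < 2 * B + 1 by lia.
  have := nodel (Ordinal hi); rewrite /= subnKC; last lia.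
  by case: sp2 => /(_ i); lia.
have bad k : L < k * B <= L + 2 * B -> altered X2 c2 (k * B).
  move=> Lk; have [] := m1 k; first lia; have [] := m2 k; first lia.
  move=> x2 _ _ x1; apply: contraT => un2.
  have un1 : ~~ altered X1 c1 (k * B).+1.
    by apply: (sparse_unaltered sp1 (erased_altered _ d1)); lia.
  have kT : (k * B).+1 < T by lia.
  have := nth_unaltered kT un1; have := nth_unaltered (ltnW kT) un2.
  have -> : size (output c1 (k * B).+1) = size (output c2 (k * B)).
    rewrite (@size_output_run c2 L (k * B)); first by have := size1 (k * B).+1; lia.
      lia.
    by move=> i ?; apply: run2; lia.
  by rewrite eqT x1 x2 => ->.
(* The two multiples of [B] that follow [L] are at most [L + 2 * B], and their distance [B] is below
   [w]. *)
have lo := ltn_ceil L (ltnW B1); have hi := leq_trunc_div L B.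
case: sp2 => _ /(_ ((L %/ B).+1 * B) ((L %/ B).+2 * B)).
by move=> /(_ _ (bad _ _) (bad _ _)); rewrite !mulSn in lo *; lia.
Qed.

Lemma syncedC c1 c2 a : synced c1 c2 a = synced c2 c1 a.
Proof. exact: eq_sym. Qed.

Lemma next_sync w B T X1 X2 c1 c2 L :
  1 < B -> 2 * B + 2 <= w -> sparse w X1 c1 -> sparse w X2 c2 ->
  marked B T X1 -> marked B T X2 -> output c1 T = output c2 T ->
  L < T -> synced c1 c2 L ->
  exists2 R, L < R <= T & R <= L + (2 * B + 2) /\ synced c1 c2 R.
Proof.
move=> B1 Bw sp1 sp2 m1 m2 eqT LT sL.
have [le1 _] := sp1; have [le2 _] := sp2; have := le1 L; have := le2 L.
case e1 : (size (c1 L)) => [|[|//]]; case e2 : (size (c2 L)) => [|[|//]] _ _.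
- exists L.+1; first lia; split; first lia.
  by rewrite /synced !outputS !size_cat e1 e2 eqn_add2r.
- exact: (next_sync_deletion B1 Bw sp1 sp2 m1 m2).
- rewrite syncedC in sL.
  have [R h [h' sR]] := next_sync_deletion B1 Bw sp2 sp1 m2 m1 (esym eqT) LT sL e2 e1.
  by exists R => //; rewrite syncedC.
- exists L.+1; first lia; split; first lia.
  by rewrite /synced !outputS !size_cat e1 e2 eqn_add2r.
Qed.

(** Let [L] be the last synchronised position up to [s], which exists since 0 is one. The next one
    given by [next_sync] lies beyond [s] by maximality. *)
Lemma last_sync w B T X1 X2 c1 c2 s :
  1 < B -> 2 * B + 2 <= w -> sparse w X1 c1 -> sparse w X2 c2 ->
  marked B T X1 -> marked B T X2 -> output c1 T = output c2 T -> s < T ->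
  exists L R, [/\ L <= s < R, R <= L + (2 * B + 2), R <= T,
    synced c1 c2 L & synced c1 c2 R].
Proof.
move=> B1 Bw sp1 sp2 m1 m2 eqT sT.
have ex0 : exists i, (i <= s) && synced c1 c2 i by exists 0.
have ub i : (i <= s) && synced c1 c2 i -> i <= s by case/andP.
case: (ex_maxnP ex0 ub) => L /andP[Ls sL] maxL.
have LT : L < T by lia.
have [R /andP[LR RT] [Rle sR]] := next_sync B1 Bw sp1 sp2 m1 m2 eqT LT sL.
exists L, R; split => //; rewrite Ls ltnNge; apply/negP => Rs.
by have := maxL R; rewrite Rs sR => /(_ isT); lia.
Qed.

(** * Agreement of blocks between synchronised positions *)

Lemma block_agree_deletion w B T X1 X2 c1 c2 L R s q1 q2 :
  sparse w X1 c1 -> sparse w X2 c2 -> output c1 T = output c2 T ->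
  L <= s -> s + B <= R -> R <= T -> R <= L + w ->
  synced c1 c2 L -> L <= q1 <= q2 -> q2 < R -> size (c1 q1) = 0 -> size (c2 q2) = 0 ->
  vt_sum B (fun j => X1 (s + j)) = vt_sum B (fun j => X2 (s + j)) %[mod 2 * B] ->
  forall j, j < B -> X1 (s + j) = X2 (s + j).
Proof.
move=> sp1 sp2 eqT Ls sR RT RL /eqP sL /andP[Lq1 q12] q2R d1 d2 vt.
have Lq1R : L <= q1 < R by lia.
have Lq2R : L <= q2 < R by lia.
have size1 := size_output_deletion sp1 Lq1R RL d1.
have size2 := size_output_deletion sp2 Lq2R RL d2.
(* Away from the deletions the symbols are intact, and the equation says that [i] and [k] have the
   same index in the two outputs. *)
have same i k : L <= i < R -> L <= k < R -> i != q1 -> k != q2 ->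
    i + (q2 < k) = k + (q1 < i) -> X1 i = X2 k.
  move=> Li Lk iq kq e.
  have un1 : ~~ altered X1 c1 i.
    by apply: (sparse_unaltered sp1 (erased_altered _ d1)); lia.
  have un2 : ~~ altered X2 c2 k.
    by apply: (sparse_unaltered sp2 (erased_altered _ d2)); lia.
  have iT : i < T by lia.
  have kT : k < T by lia.
  have := nth_unaltered iT un1; have := nth_unaltered kT un2.
  have -> : size (output c1 i) = size (output c2 k).
    by have := size1 i; have := size2 k; lia.
  by rewrite eqT => -> [].
have outer i : L <= i < R -> (i < q1) || (q2 < i) -> X1 i = X2 i.
  by move=> Li hi; apply: same; lia.
case: (ltnP q2 s) => [q2s|sq2].
  by move=> j jB; apply: outer; lia.
case: (leqP (s + B) q1) => [q1s|sq1].
  by move=> j jB; apply: outer; lia.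
case: (posnP B) => [B0 j|B0]; first by rewrite B0.
(* A deletion outside the block acts like one at its nearer end: truncated subtraction sends
   [q1 < s] to 0, and the minimum sends a [q2] beyond the block to the last index. *)
apply: (@vt_deletions B _ _ (q1 - s) (minn q2 (s + B.-1) - s)) => //.
- lia.
- by move=> j hj; apply: outer; lia.
- by move=> j hj; apply: same; lia.
- by move=> j hj; apply: outer; lia.
Qed.

(** Equal lengths at [L] and at [R] force either both channels or neither to delete in between. In
    the first case the blocks are compared up to one deletion each; in the second the symbols are
    aligned and the blocks differ in at most two positions. *)
Lemma block_agree w B T X1 X2 c1 c2 L R s :
  sparse w X1 c1 -> sparse w X2 c2 -> output c1 T = output c2 T ->
  L <= s -> s + B <= R -> R <= T -> R <= L + w ->
  synced c1 c2 L -> synced c1 c2 R ->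
  vt_sum B (fun j => X1 (s + j)) = vt_sum B (fun j => X2 (s + j)) %[mod 2 * B] ->
  forall j, j < B -> X1 (s + j) = X2 (s + j).
Proof.
move=> sp1 sp2 eqT Ls sR RT RL sL sR' vt.
have LR : L <= R by lia.
have del X c : sparse w X c ->
    (exists2 q, L <= q < R & size (c q) = 0) \/
    (forall i, L <= i < R -> size (c i) = 1).
  move=> [le _]; case: (boolP [exists i : 'I_(R - L), size (c (L + i)) == 0]).
    case/existsP => i /eqP d; left; exists (L + i) => //.
    by have := ltn_ord i; lia.
  move/existsPn => h; right => i Li.
  have hi : i - L < R - L by lia.
  by have := h (Ordinal hi); rewrite /= subnKC; [have := le i; lia | lia].
have [[q1 Lq1 d1]|run1] := del _ _ sp1; have [[q2 Lq2 d2]|run2] := del _ _ sp2.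
- case: (leqP q1 q2) => q12.
    by apply: (block_agree_deletion sp1 sp2 eqT Ls sR RT RL sL _ _ d1 d2); lia.
  move=> j jB; apply/esym; move: j jB; rewrite syncedC in sL.
  by apply: (block_agree_deletion sp2 sp1 (esym eqT) Ls sR RT RL sL _ _ d2 d1); lia.
- have := @size_output_deletion _ _ _ sp1 L R q1 Lq1 RL d1 R.
  by have := size_output_run LR run2; move/eqP: sL; move/eqP: sR'; lia.
- have := @size_output_deletion _ _ _ sp2 L R q2 Lq2 RL d2 R.
  by have := size_output_run LR run1; move/eqP: sL; move/eqP: sR'; lia.
have same i : L <= i < R -> c1 i = c2 i.
  move=> Li; rewrite (@output_nth c1 i T) ?run1 //; last lia.
  rewrite (@output_nth c2 i T) ?run2 //; last lia.
  rewrite eqT; congr [:: nth _ _ _].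
  rewrite (@size_output_run c1 L i); first rewrite (@size_output_run c2 L i).
  - by rewrite (eqP sL).
  - lia.
  - by move=> k ?; apply: run2; lia.
  - lia.
  - by move=> k ?; apply: run1; lia.
have agree i : L <= i < R -> ~~ altered X1 c1 i -> ~~ altered X2 c2 i -> X1 i = X2 i.
  by move=> /same e /negPn/eqP e1 /negPn/eqP e2; move: e; rewrite e1 e2 => -[].
(* Each channel alters at most one position of the block, position [B] standing for none. *)
have unique X c : sparse w X c -> exists a, forall j, j < B -> j != a ->
    ~~ altered X c (s + j).
  move=> sp; case: (boolP [exists i : 'I_B, altered X c (s + i)]).
    case/existsP => i ai; exists (nat_of_ord i) => j jB ji.
    by apply: (sparse_unaltered sp ai); have := ltn_ord i; lia.
  by move/existsPn => h; exists B => j jB _; apply: (h (Ordinal jB)).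
have [a ha] := unique _ _ sp1; have [b hb] := unique _ _ sp2.
have vtab : forall j, j < B -> j != a -> j != b -> X1 (s + j) = X2 (s + j).
  by move=> j jB ja jb; apply: agree; [lia | exact: ha | exact: hb].
case: (leqP a b) => ab; first exact: (@vt_flips B _ _ a b).
by apply: (@vt_flips B _ _ b a) => //; [exact: ltnW | move=> j jB jb ja; apply: vtab].
Qed.

(** The constant: [L] lies at most [2 * B + 1] before the block and [R] at most [2 * B + 1] after
    its end, whence [R - L <= 5 * B + 2]. *)
Lemma decode_block w B T X1 X2 c1 c2 s :
  1 < B -> 5 * B + 2 <= w -> sparse w X1 c1 -> sparse w X2 c2 ->
  marked B T X1 -> marked B T X2 -> output c1 T = output c2 T -> s + B <= T ->
  vt_sum B (fun j => X1 (s + j)) = vt_sum B (fun j => X2 (s + j)) %[mod 2 * B] ->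
  forall j, j < B -> X1 (s + j) = X2 (s + j).
Proof.
move=> B1 Bw sp1 sp2 m1 m2 eqT sT.
have Bw' : 2 * B + 2 <= w by lia.
have sync := last_sync B1 Bw' sp1 sp2 m1 m2 eqT.
have [L [R0 [Ls R0le _ sL _]]] := sync s ltac:(lia).
have [L0 [R [Rs Rle RT _ sR]]] := sync (s + B.-1) ltac:(lia).
by apply: (@block_agree w B T X1 X2 c1 c2 L R) => //; lia.
Qed.

(** * The block code *)

Section Channel.
Context (n : nat).
Implicit Types (x y : word n) (g : pattern n).

Definition bit x (k : nat) : bool := if insub k is Some i then x i else false.

(** Beyond the word the default agrees with that of [bit], so no position from [n] on counts as
    altered. *)
Definition cell x g (k : nat) : seq osym :=
  if insub k is Some i then corrupt_at x g i else [:: Some false].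

Lemma bitE x (i : 'I_n) : bit x i = x i. Proof. by rewrite /bit valK. Qed.

Lemma cellE x g (i : 'I_n) : cell x g i = corrupt_at x g i.
Proof. by rewrite /cell valK. Qed.

Lemma corrupt_prefixE x g T : T <= n -> corrupt_prefix x g T = output (cell x g) T.
Proof.
move=> Tn; rewrite /corrupt_prefix /output -(@filter_iota_ltn 0 n T) //.
rewrite -val_enum_ord filter_map -map_comp; congr flatten.
by apply: eq_map => i /=; rewrite cellE.
Qed.

(** Stated on the error bits alone, so that the corrected set of patterns does not depend on the
    codeword. *)
Definition spread (w : nat) g : bool :=
  [forall i : 'I_n, forall j : 'I_n,
    [&& i < j, (g i).1 & (g j).1] ==> (i + w <= j)].

Lemma altered_error x g k : altered (bit x) (cell x g) k ->
  exists2 i : 'I_n, k = i & (g i).1.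
Proof.
rewrite /altered /bit /cell; case: insubP => [i _ <-|]; last by rewrite eqxx.
by rewrite /corrupt_at; case: ifP => [gi _|_]; [exists i | rewrite eqxx].
Qed.

Lemma sparse_cell w x g : spread w g -> sparse w (bit x) (cell x g).
Proof.
move=> /forallP h; split=> [k|k l kl /altered_error[i ki gi] /altered_error[j lj gj]].
  rewrite /cell; case: insubP => // i _ _; rewrite /corrupt_at.
  by case: ifP => // _; case: (g i).2.
by subst k l; have /forallP/(_ j) := h i; rewrite kl gi gj.
Qed.

Definition vt_block B x b := vt_sum B (fun j => bit x (b * B + j)).

Definition block_code B (C : {set word n}) :=
  (forall x, x \in C -> marked B n (bit x)) /\
  (forall x1 x2 b, x1 \in C -> x2 \in C -> b <= n %/ B ->
     vt_block B x1 b = vt_block B x2 b %[mod 2 * B]).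

Lemma block_code_corrects B (C : {set word n}) (F : {set pattern n}) :
  1 < B -> block_code B C -> (forall g, g \in F -> spread (5 * B + 2) g) ->
  rt_corrects C F B.
Proof.
move=> B1 [mC vtC] sF; apply/forallP => z; apply/implyP => /andP[z1 zn].
apply/forallP => g1; apply/implyP => /sF sp1; apply/forallP => g2; apply/implyP => /sF sp2.
apply/forallP => x1; apply/implyP => xC1; apply/forallP => x2; apply/implyP => xC2.
apply/implyP => /existsP[i /andP[iz]]; apply: contra => /eqP.
have zBn : z + B <= n by have := ltn_ord z; lia.
rewrite !corrupt_prefixE // => eqT.
have m1 : marked B (z + B) (bit x1) by move=> k hk; apply: mC => //; lia.
have m2 : marked B (z + B) (bit x2) by move=> k hk; apply: mC => //; lia.
have ei := divn_eq i B; have li : i %% B < B by rewrite ltn_mod ltnW.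
(* The block of a position [i < z] ends before [z + B], so delay [B] reveals all of it. *)
have iB : i %/ B * B + B <= z + B by lia.
have vti := vtC x1 x2 (i %/ B) xC1 xC2 (leq_div2r B (ltnW (ltn_ord i))).
have := decode_block B1 (leqnn _) (sparse_cell x1 sp1) (sparse_cell x2 sp2) m1 m2 eqT iB vti.
by move=> /(_ _ li); rewrite -ei !bitE => ->.
Qed.

Definition mark B y : word n :=
  [ffun i : 'I_n => if i %% B == 0 then false else if i %% B == 1 then true else y i].

Lemma marked_mark B y : 1 < B -> marked B n (bit (mark B y)).
Proof.
move=> B1 k kn; have kn' := ltnW kn; split.
  by rewrite -[k * B]/(val (Ordinal kn')) bitE ffunE /= modnMl.
rewrite -[(k * B).+1]/(val (Ordinal kn)) bitE ffunE /=.
by have -> : (k * B).+1 %% B = 1 by rewrite -addn1 modnMDl modn_small.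
Qed.

End Channel.

(** * Existence of a large block code *)

Lemma pigeonhole (T S : finType) (f : T -> S) : 0 < #|S| ->
  exists s, #|T| <= #|[set u | f u == s]| * #|S|.
Proof.
move=> /card_gt0P[s0 _].
pose s := [arg max_(s > s0) #|[set u | f u == s]|]; exists s.
rewrite -[#|T|]sum1_card (partition_big f predT) //=.
apply: (@leq_trans (\sum_(r : S) #|[set u | f u == s]|)); last first.
  by rewrite sum_nat_const mulnC.
apply: leq_sum => r _; rewrite sum1_card -cardsE.
by rewrite /s; case: arg_maxnP => // s' _; apply.
Qed.

Lemma block_code_exists n B : 1 < B ->
  exists C : {set word n}, block_code B C /\ 2 ^ n <= #|C| * (8 * B) ^ (n %/ B).+1.
Proof.
move=> B1; have B2 : 0 < 2 * B by lia.
(* Each block is labelled by the sum of the marked word and the two bits that its marker overwrites,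
   [2 * B * 4] values in all. The stored bits make [mark] injective on a fibre. *)
pose syn (y : word n) : {ffun 'I_(n %/ B).+1 -> 'I_(2 * B) * (bool * bool)} :=
  [ffun b : 'I_(n %/ B).+1 => (Ordinal (ltn_pmod (vt_block B (mark B y) b) B2),
           (bit y (b * B), bit y (b * B).+1))].
have cardS : #|{ffun 'I_(n %/ B).+1 -> 'I_(2 * B) * (bool * bool)}| = (8 * B) ^ (n %/ B).+1.
  by rewrite card_ffun !card_prod !card_ord card_bool; congr (_ ^ _); lia.
have [|s] := pigeonhole syn; first by rewrite cardS expn_gt0; lia.
rewrite card_ffun card_ord card_bool cardS => hs.
exists [set mark B y | y in [set u | syn u == s]]; split; last first.
  rewrite card_in_imset // => y1 y2; rewrite !inE => /eqP <- /eqP e12 em.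
  apply/ffunP => i; have ei := divn_eq i B.
  have bi : i %/ B < (n %/ B).+1 by rewrite ltnS leq_div2r // ltnW.
  have /ffunP/(_ (Ordinal bi)) := e12; rewrite !ffunE /= => -[_ e0 e1].
  have /ffunP/(_ i) := em; rewrite !ffunE.
  case: eqP => [i0 _|_]; last case: eqP => [i1 _|//].
    by move: e0; rewrite -[i %/ B * B]addn0 -i0 -ei !bitE.
  by move: e1; rewrite -[(i %/ B * B).+1]addn1 -i1 -ei !bitE.
split=> [x /imsetP[y _ ->]|x1 x2 b]; first exact: marked_mark.
move=> /imsetP[y1 + ->] /imsetP[y2 + ->]; rewrite !inE => /eqP <- /eqP/ffunP + bn.
by move=> /(_ (Ordinal (bn : b < (n %/ B).+1))); rewrite !ffunE => -[].
Qed.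

(** * Counting patterns with two close errors *)

Section BadPatterns.
Context (n t : nat).
Local Notation E := (errpats n t).

Definition joint (i j : 'I_n) : nat := \sum_(g in E) (g i).1 * (g j).1.

(** Permuting the positions of a pattern keeps its number of errors, hence is a bijection of [E]. *)
Lemma joint_perm (s : {perm 'I_n}) i j : joint (s i) (s j) = joint i j.
Proof.
pose h (s : {perm 'I_n}) (g : pattern n) : pattern n := [ffun u => g (s u)].
have hK : cancel (h s) (h s^-1%g).
  by move=> g; apply/ffunP => u; rewrite !ffunE permKV.
rewrite /joint [RHS](reindex_inj (can_inj hK)) /=; apply: eq_big => [g|g _].
  rewrite !inE; congr (_ <= _); rewrite (reindex_inj (@perm_inj _ s)) /=.
  by apply: eq_bigr => u _; rewrite ffunE.
by rewrite !ffunE.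
Qed.

Lemma joint_const i j k l : i != j -> k != l -> joint i j = joint k l.
Proof.
(* Double transitivity: the first transposition sends [i] to [k], the second sends the image of [j]
   to [l] and fixes [k]. *)
move=> ij kl; pose s := (tperm i k * tperm (tperm i k j) l)%g.
have neq : tperm i k j != k.
  by apply: contra ij => /eqP e; rewrite -(inj_eq (@perm_inj _ (tperm i k))) tpermL e.
by rewrite -(joint_perm s) !permM !tpermL (tpermD neq) 1?eq_sym.
Qed.

(** For each pattern the double sum factors into the square of its number of errors. *)
Lemma sum_joint : \sum_i \sum_j joint i j <= t ^ 2 * #|E|.
Proof.
rewrite mulnC -sum_nat_const; under eq_bigr do rewrite exchange_big /=.
rewrite exchange_big /=; apply: leq_sum => g; rewrite inE => gt.
under eq_bigr do rewrite -big_distrr /=.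
by rewrite -big_distrl /= -mulnn leq_mul.
Qed.

Lemma card_window w (i : 'I_n) : #|[pred j : 'I_n | i < j < i + w]| <= w.-1.
Proof.
rewrite cardE -(size_map val) -(size_iota i.+1 w.-1); apply: uniq_leq_size.
  by rewrite map_inj_uniq ?enum_uniq //; apply: val_inj.
by move=> k /mapP[j]; rewrite mem_enum inE mem_iota => ? -> /=; lia.
Qed.

(** Union bound: a pattern that is not spread has errors at some [i < j < i + w]. With [J] the
    common joint count there are at most [n * (w.-1 * J)] of these, while all ordered pairs give
    [n * (n.-1 * J) <= t ^ 2 * #|E|]. *)
Lemma card_not_spread w :
  n.-1 * #|E :\: [set g | spread w g]| <= w.-1 * (t ^ 2 * #|E|).
Proof.
case: (leqP n 1) => [n1|n1]; first by have -> : n.-1 = 0 by lia.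
pose J := joint (Ordinal (ltnW n1)) (Ordinal n1).
have badJ : #|E :\: [set g | spread w g]| <= n * (w.-1 * J).
  apply: (@leq_trans (\sum_(i < n) \sum_(j < n | i < j < i + w) joint i j)).
    under eq_bigr do rewrite exchange_big /=.
    rewrite exchange_big /= -sum1_card.
    rewrite [X in _ <= X](bigID (fun g => spread w g)) /=.
    apply: leq_trans (leq_addl _ _).
    rewrite (eq_bigl (fun g => (g \in E) && ~~ spread w g)); last first.
      by move=> g; rewrite !inE andbC.
    apply: leq_sum => g /andP[_ /forallPn[i /forallPn[j]]].
    rewrite negb_imply => /andP[/and3P[ij gi gj]]; rewrite -ltnNge => jw.
    rewrite (bigD1 i) //= (bigD1 j) /=; last by rewrite ij.
    by rewrite gi gj.
  rewrite -[X in X * _]card_ord -sum_nat_const; apply: leq_sum => i _.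
  rewrite (eq_bigr (fun=> J)); last first.
    by move=> j ij; apply: joint_const => //; apply/eqP => e; move: ij; rewrite e; lia.
  by rewrite sum_nat_const leq_mul2r card_window orbT.
have JE : n * (n.-1 * J) <= t ^ 2 * #|E|.
  apply: leq_trans sum_joint; rewrite -[X in X * _]card_ord -sum_nat_const.
  apply: leq_sum => i _; rewrite (bigID (fun j => j != i)) /=.
  apply: leq_trans (leq_addr _ _); rewrite (eq_bigr (fun=> J)); last first.
    by move=> j ij; apply: joint_const => //; rewrite eq_sym.
  rewrite sum_nat_const leq_mul2r; apply/orP; right.
  by have := cardC1 i; rewrite card_ord => <-.
apply: leq_trans (leq_mul (leqnn n.-1) badJ) _.
by apply: leq_trans (leq_mul (leqnn w.-1) JE); lia.
Qed.

End BadPatterns.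

Lemma code_exists n t B : 1 < B ->
  exists C : {set word n}, 2 ^ n <= #|C| * (8 * B) ^ (n %/ B).+1 /\
    n.-1 * (#|errpats n t| - max_rt_corrected C t B)
      <= (5 * B + 1) * (t ^ 2 * #|errpats n t|).
Proof.
move=> B1; have [C [bC cardC]] := block_code_exists n B1; exists C; split=> //.
have -> : 5 * B + 1 = (5 * B + 2).-1 by rewrite addn2 addn1.
apply: leq_trans (card_not_spread n t (5 * B + 2)); rewrite leq_mul2l; apply/orP; right.
set S := [set g | _]; have := cardsID S (errpats n t).
(* The spread patterns in [errpats n t] form one corrected set, so the maximum is at least their
   number. *)
suff h : #|errpats n t :&: S| <= max_rt_corrected C t B.
  by move=> <-; rewrite leq_subLR leq_add2r.
apply: (leq_bigmax_cond (F := fun F : {set pattern n} => #|F|)).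
rewrite subsetIl /=; apply: block_code_corrects => // g.
by case/setIP => _; rewrite inE.
Qed.

(** * Real estimates of redundancy and error probability *)

Local Open Scope R_scope.

Lemma INR_expn a k : INR (a ^ k)%N = INR a ^ k.
Proof. by elim: k => [|k IH] //=; rewrite expnS mult_INR IH. Qed.

Lemma ln_le x y : 0 < x -> x <= y -> ln x <= ln y.
Proof. by move=> x0 [/(ln_increasing _ _ x0)/Rlt_le|->]; last exact: Rle_refl. Qed.

Lemma redundancy_bound n d m (C : {set word n}) :
  (0 < d)%N -> INR m * INR d <= 2 * INR n -> (0 < #|C|)%N ->
  (2 <= INR d) ->
  (2 ^ n <= #|C| * (8 * d) ^ m)%N ->
  redundancy C <= INR n * (4 * log2 (2 * INR d) / INR d).
Proof.
move=> d0 md C0 d2 card.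
have dpos : 0 < INR d by lra.
have Cpos : 0 < INR #|C| by apply: lt_0_INR; apply/ltP.
have l2 : 0 < ln 2 by rewrite -ln_1; apply: ln_increasing; lra.
have /le_INR := elimT leP card; rewrite mult_INR !INR_expn mult_INR => h.
have e8 : INR 8 = 8 by rewrite /=; lra.
have e2 : INR 2 = 2 by rewrite /=; lra.
rewrite e8 e2 in h.
have {}h : INR n * ln 2 <= ln (INR #|C|) + INR m * ln (8 * INR d).
  rewrite -!ln_pow; try lra.
  rewrite -ln_mult //; last by apply: pow_lt; lra.
  by apply: ln_le => //; apply: pow_lt; lra.
(* Here [8 * d <= (2 * d) ^ 2] because [d >= 2]; with [m <= 2 * n / d] this yields the factor 4. *)
have l8 : ln (8 * INR d) <= 2 * ln (2 * INR d).
  have -> : 2 * ln (2 * INR d) = ln ((2 * INR d) * (2 * INR d)).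
    by rewrite (ln_mult (2 * INR d) (2 * INR d)); lra.
  by apply: ln_le; nra.
have lpos : 0 <= ln (2 * INR d).
  by rewrite -ln_1; apply: ln_le; lra.
have mle : INR m <= 2 * INR n / INR d.
  by apply: (Rmult_le_reg_r (INR d)) => //; field_simplify; lra.
have bound : INR m * ln (8 * INR d) <= 2 * INR n / INR d * (2 * ln (2 * INR d)).
  apply: Rle_trans (Rmult_le_compat_l _ _ _ (pos_INR m) l8) _.
  by apply: Rmult_le_compat_r => //; lra.
rewrite /redundancy /log2; apply: (Rmult_le_reg_r (ln 2)) => //.
have -> : (INR n - ln (INR #|C|) / ln 2) * ln 2 = INR n * ln 2 - ln (INR #|C|).
  by field; lra.
have -> : INR n * (4 * (ln (2 * INR d) / ln 2) / INR d) * ln 2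
   = 2 * INR n / INR d * (2 * ln (2 * INR d)) by field; lra.
lra.
Qed.

Theorem theorem1 (n t d : nat) :
  (0 < n)%N ->
  (1 <= t)%N ->
  INR t <= Rpower (INR n) (1 / 3) / 6 ->
  (4 * t <= d)%N ->
  INR d <= 2 * INR n / (3 * INR t ^ 2) ->
  exists C : {set word n},
    (0 < #|C|)%N /\
    redundancy C <= INR n * (4 * log2 (2 * INR d) / INR d) /\
    rt_error_prob C t d <= 11 * (INR t ^ 2 * INR d) / INR n.
Proof.
move=> n0 t1 _ td dn.
have d4 : (4 <= d)%N by lia.
have t1R : 1 <= INR t by apply: (le_INR 1); apply/leP.
have d4R : 4 <= INR d by have /le_INR := elimT leP d4; rewrite /=; lra.
have tt : 1 <= INR t ^ 2 by rewrite /=; nra.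
have dnR : INR d * (3 * INR t ^ 2) <= 2 * INR n.
  have -> : 2 * INR n = 2 * INR n / (3 * INR t ^ 2) * (3 * INR t ^ 2) by field; nra.
  by apply: Rmult_le_compat_r => //; lra.
have dn3 : 3 * INR d <= 2 * INR n.
  apply: Rle_trans dnR; rewrite Rmult_comm; apply: Rmult_le_compat_l; lra.
have nR : 6 <= INR n by lra.
have [C [card bad]] := @code_exists n t d (ltac:(lia)).
have C0 : (0 < #|C|)%N.
  by case: posnP card => // ->; rewrite mul0n leqn0 expn_eq0.
exists C; split=> //; split.
  (* With [m = n %/ d + 1] blocks, [m * d <= n + d <= 2 * n]. *)
  apply: (redundancy_bound _ _ C0 _ card); [lia | | lra].
  have /le_INR := elimT leP (leq_trunc_div n d).
  by rewrite S_INR mult_INR; lra.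
have E0 : (0 < #|errpats n t|)%N.
  apply/card_gt0P; exists [ffun=> (false, SD)]; rewrite inE.
  by rewrite big1 // => i _; rewrite ffunE.
have E0R : 0 < INR #|errpats n t| by apply: lt_0_INR; apply/ltP.
have n1R : INR n.-1 = INR n - 1 by rewrite -{2}(prednK n0) S_INR; lra.
have /le_INR := elimT leP bad.
rewrite !mult_INR plus_INR mult_INR n1R.
have -> : INR t * INR t = INR t ^ 2 by rewrite /=; lra.
have -> : INR 5 = 5 by rewrite /=; lra.
have -> : INR 1 = 1 by [].
rewrite /rt_error_prob; set b := INR (_ - _)%N; set e := INR #|_| => h.
have e0 : 0 < e by [].
have b0 : 0 <= b by apply: pos_INR.
(* Since [n >= 2], passing from [n - 1] to [n] costs a factor 2; then [2 * (5 * d + 1) <= 11 * d]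
   gives the constant 11. *)
have hb : INR n * b <= 2 * ((INR n - 1) * b).
  have : 0 <= (INR n - 2) * b by apply: Rmult_le_pos; lra.
  lra.
have he : 0 <= INR t ^ 2 * e by apply: Rmult_le_pos; lra.
have hd : 2 * ((5 * INR d + 1) * (INR t ^ 2 * e)) <= 11 * INR d * (INR t ^ 2 * e).
  have : 0 <= (INR d - 2) * (INR t ^ 2 * e) by apply: Rmult_le_pos; lra.
  lra.
apply: (Rmult_le_reg_r (e * INR n)); first by apply: Rmult_lt_0_compat; lra.
have -> : b / e * (e * INR n) = INR n * b by field; lra.
have -> : 11 * (INR t ^ 2 * INR d) / INR n * (e * INR n) = 11 * INR d * (INR t ^ 2 * e).
  by field; lra.
lra.
Qed.
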